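(* The set $\sigma_\infty$ of all eigenvalues of finite tridiagonal sign matrices is dense in the closed unit disk $\mathbb{D}=\{z\in\mathbb{C}:|z|\le 1\}$, i.e. $\overline{\sigma_\infty}\cap\mathbb{D}=\mathbb{D}$, where $\overline{\sigma_\infty}$ denotes the closure of $\sigma_\infty$ in $\mathbb{C}$.
   Context: $\mathbb{N}=\{1,2,3,\dots\}$, and $\operatorname{sp}(\cdot)$ denotes the spectrum (set of eigenvalues) of a matrix. For $n\in\mathbb{N}$ and $k,l\in\{\pm1\}^n$, let $A^{k,l}_{fin}\in\mathbb{C}^{(n+1)\times(n+1)}$ be the tridiagonal matrix with zero diagonal, subdiagonal $k_1,\dots,k_n$ and superdiagonal $l_1,\dots,l_n$; that is, $(A^{k,l}_{fin})_{j+1,j}=k_j$ and $(A^{k,l}_{fin})_{j,j+1}=l_j$ for $1\le j\le n$, all other entries being $0$. These are the finite tridiagonal sign matrices. Define $$\sigma_\infty := \bigcup_{n\in\mathbb{N}}\ \bigcup_{k,l\in\{\pm1\}^n}\operatorname{sp}(A^{k,l}_{fin}).$$ *)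

(* Defs.v *)
From HB Require Import structures.
From mathcomp Require Import all_boot all_order all_algebra.
From mathcomp Require Import all_classical all_reals all_analysis.
From mathcomp Require Export complex.

Set Implicit Arguments.
Unset Strict Implicit.
Unset Printing Implicit Defensive.

Import Order.TTheory GRing.Theory Num.Theory.
Import numFieldNormedType.Exports.

Local Open Scope classical_set_scope.
Local Open Scope ring_scope.

(* [k] and [l] are 0-indexed: [k`_j] is the entry in row j+1, column j, which
   exists exactly when j < n, so the default value of [nth] is never read. *)
Definition tridiag (F : fieldType) (n : nat) (k l : n.-tuple F) :
    'M[F]_n.+1 :=
  \matrix_(i, j) (if i == j.+1 :> nat then k`_j
                  else if j == i.+1 :> nat then l`_i
                  else 0).

Definition sign_vectors (F : fieldType) (n : nat) : set (n.-tuple F) :=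
  [set k | forall i : 'I_n, tnth k i = 1 \/ tnth k i = -1].

Arguments sign_vectors : clear implicits.

(* [eigenvalue] is defined by row vectors (v *m A = z *: v with v != 0); a
   matrix over a field and its transpose have the same eigenvalues. *)
Definition spectrum (F : fieldType) (m : nat) (A : 'M[F]_m) : set F :=
  [set z | eigenvalue A z].

Definition sigma_infty (F : fieldType) : set F :=
  \bigcup_(n in [set n : nat | (0 < n)%N])
    \bigcup_(k in sign_vectors F n) \bigcup_(l in sign_vectors F n)
      spectrum (tridiag k l).

Arguments sigma_infty : clear implicits.

(* On R[i], `|z| is the modulus embedded in R[i], and x <= y in R[i] means that
   y - x is real and nonnegative, so `|z| <= 1 is the usual inequality. *)
Definition closed_unit_disk (C : numFieldType) : set C :=
  [set z | `|z| <= 1].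

Arguments closed_unit_disk : clear implicits.

(* Main.v *)
Require Import Defs.
From mathcomp Require Import all_boot all_order all_algebra.
From mathcomp Require Import all_classical all_reals all_analysis.
From mathcomp Require Import ring zify.

Set Implicit Arguments.
Unset Strict Implicit.
Unset Printing Implicit Defensive.

Import Order.TTheory GRing.Theory Num.Theory.
Import numFieldNormedType.Exports.
Local Open Scope classical_set_scope.
Local Open Scope ring_scope.

(** The roots of the characteristic polynomials [p_n], given by
    [p_(j+2) = z p_(j+1) - c_j p_j] with signs [c_j], are stable under square
    roots: a suitable sign sequence [d] satisfies
    [p^d_(2j+1)(z) = z p^c_j(z^2)].  For [c = 1] the [p_n] are Chebyshev
    polynomials of the second kind, whose roots [w + 1/w] with [w] a root of
    unity accumulate on all of [[0, 1]].  So the closure of the root set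
    contains every [w] with [w^(2^k)] in [[0, 1]]; these lie on the rays with
    dyadic angles, and are dense in the disk. *)

Fixpoint signpoly {F : fieldType} (c : nat -> bool) (z : F) (n : nat) : F :=
  match n with
  | 0 => 1
  | n'.+1 => if n' is m.+1
             then z * signpoly c z n' - (-1) ^+ c m * signpoly c z m
             else z
  end.

Lemma signpolySS {F : fieldType} c (z : F) n :
  signpoly c z n.+2 = z * signpoly c z n.+1 - (-1) ^+ c n * signpoly c z n.
Proof. by []. Qed.

Definition signroots (F : fieldType) : set F :=
  [set z | exists2 n, (0 < n)%N & exists c, signpoly c z n.+1 = 0].

Arguments signroots : clear implicits.

(** With subdiagonal 1 and superdiagonal [(-1) ^+ c i], the row (p_0(z), ..., p_n(z)) is a left
    eigenvector for z: column j reads p_(j+1) + (-1)^(c_(j-1)) p_(j-1) = z p_j, and the last column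
    closes up because p_(n+1)(z) = 0. *)
Lemma signroots_sub_sigma_infty (F : fieldType) :
  signroots F `<=` sigma_infty F.
Proof.
move=> z [n n0 [c pz]].
pose k : n.-tuple F := [tuple 1 | i < n].
pose l : n.-tuple F := [tuple (-1) ^+ c i | i < n].
exists n => //; exists k => [i|]; first by rewrite tnth_mktuple; left.
exists l => [i|].
  by rewrite tnth_mktuple; case: (c i); [right | left].
apply/eigenvalueP; exists (\row_j signpoly c z j); last first.
  by apply/eqP => /rowP/(_ ord0); rewrite !mxE => /eqP; rewrite oner_eq0.
apply/rowP => j; rewrite !mxE.
have nthl m : (m < n)%N -> l`_m = (-1) ^+ c m.
  by move=> mn; rewrite -(tnth_nth _ _ (Ordinal mn)) tnth_mktuple.
have nthk m : (m < n)%N -> k`_m = 1.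
  by move=> mn; rewrite -(tnth_nth _ _ (Ordinal mn)) tnth_mktuple.
under eq_bigr => i _ do rewrite !mxE.
rewrite (eq_bigr (fun i : 'I_n.+1 =>
  (if i == j.+1 :> nat then signpoly c z i * k`_j else 0) +
  (if i.+1 == j :> nat then signpoly c z i * l`_i else 0))); last first.
  move=> i _; case: (eqVneq (i : nat) j.+1) => [ij|_].
    rewrite ifF ?addr0//; apply/eqP; lia.
  by rewrite add0r eq_sym; case: ifP => // _; rewrite mulr0.
rewrite big_split/= -!big_mkcond/=.
rewrite (big_ord1_eq _ (fun i => signpoly c z i * k`_j)).
have -> : (if (j.+1 < n.+1)%N then signpoly c z j.+1 * k`_j else 0)
          = signpoly c z j.+1.
  case: ltnP => jn; first by rewrite nthk// mulr1.
  (* In the last column the matrix has no entry below the diagonal; the missing term is p_(n+1)(z) =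
     0. *)
  by have -> : j.+1 = n.+1; [case: j jn => /= j; lia | rewrite pz].
case: j => -[|j] jn /=.
  by rewrite big_pred0// addr0 mulr1.
under eq_bigl => i do rewrite eqSS.
rewrite (big_ord1_eq _ (fun i => signpoly c z i * l`_i)) ltnW// nthl//.
by rewrite [_ * (-1) ^+ _]mulrC subrK.
Qed.

(** * Stability of the root set under square roots *)

(* [dsign c j] is the sign d_(2j) in the doubled sequence d, which is chosen
   with d_(2j+1) = - d_(2j) and d_(2j) * d_(2j-1) = c_(j-1). *)
Fixpoint dsign (c : nat -> bool) (j : nat) : bool :=
  if j is i.+1 then ~~ (c i (+) dsign c i) else false.

Definition doubling (c : nat -> bool) (m : nat) : bool :=
  odd m (+) dsign c m./2.

(** Both parities are carried together. In the odd step d_(2j+1) = - d_(2j) cancels the p_j terms;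
    in the even step d_(2j+2) d_(2j) = - c_j restores the recurrence of p at z^2. *)
Lemma signpoly_doubling (F : fieldType) c (z : F) j :
  signpoly (doubling c) z j.*2.+1 = z * signpoly c (z ^+ 2) j /\
  signpoly (doubling c) z j.*2.+2 =
    signpoly c (z ^+ 2) j.+1 - (-1) ^+ dsign c j * signpoly c (z ^+ 2) j.
Proof.
elim: j => [|j [IH1 IH2]].
  by split; [rewrite mulr1 | rewrite signpolySS /=; ring].
have E : (-1) ^+ dsign c j.+1 * (-1) ^+ dsign c j = - (-1) ^+ c j :> F.
  by rewrite /=; case: (c j); case: (dsign c j); rewrite /= ?expr0 ?expr1; ring.
have oddE : signpoly (doubling c) z j.+1.*2.+1 = z * signpoly c (z ^+ 2) j.+1.
  rewrite doubleS signpolySS IH2 IH1 /doubling /= odd_double uphalf_double.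
  by case: (dsign c j); rewrite /= ?expr0 ?expr1; ring.
split=> //.
rewrite signpolySS oddE doubleS IH2 signpolySS /doubling -doubleS.
rewrite odd_double doubleK addFb.
rewrite mulrBr [(-1) ^+ dsign c j.+1 * ((-1) ^+ _ * _)]mulrA E; ring.
Qed.

Lemma signroots_sqrt (F : fieldType) (z : F) :
  signroots F (z ^+ 2) -> signroots F z.
Proof.
move=> [n n0 [c pz]]; exists n.+1.*2 => //; exists (doubling c).
by have [-> _] := signpoly_doubling c z n.+1; rewrite pz mulr0.
Qed.

(** * Chebyshev polynomials and roots of unity *)

(** For w = e^(i theta) this is sin(theta) U_n(cos(theta)) = sin((n+1) theta). *)
Lemma signpoly_chebyshev (F : fieldType) (w : F) n : w != 0 ->
  (w - w^-1) * signpoly xpred0 (w + w^-1) n = w ^+ n.+1 - w ^- n.+1.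
Proof.
move=> w0; suff [] : (w - w^-1) * signpoly xpred0 (w + w^-1) n
    = w ^+ n.+1 - w ^- n.+1 /\
  (w - w^-1) * signpoly xpred0 (w + w^-1) n.+1 = w ^+ n.+2 - w ^- n.+2 by [].
elim: n => [|n [IH1 IH2]]; first by split=> /=; field.
split=> //; rewrite signpolySS mulrBr expr0 mul1r IH1 mulrCA IH2.
rewrite -!exprVn !exprS; move: (w ^+ n) (w^-1 ^+ n) => a b; by field.
Qed.

Lemma unity_root_signroots (F : fieldType) (w : F) n : (2 < n)%N ->
  w ^+ (n.*2) = 1 -> w ^+ 2 != 1 -> signroots F (w + w^-1).
Proof.
move=> n2 wn w2.
have wU : w \is a GRing.unit.
  by rewrite -(unitrX_pos w (_ : 0 < n.*2)%N) ?wn ?unitr1//; lia.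
have w0 : w != 0 by rewrite -unitfE.
case: n n2 wn => [|[|n]]// n1 wn; exists n => //; exists xpred0.
have d0 : w - w^-1 != 0.
  apply: contra w2; rewrite subr_eq0 => /eqP e.
  by rewrite expr2 {2}e mulfV.
apply: (mulfI d0); rewrite mulr0 signpoly_chebyshev//.
have wn0 : w ^+ n.+2 != 0 by rewrite expf_neq0.
apply: (mulfI wn0); rewrite mulr0 mulrBr mulfV// -exprD addnn wn.
exact: subrr.
Qed.

(** * Approximation in the complex plane *)

Section ComplexApproximation.
Variable C : numClosedFieldType.
Implicit Types (z w : C).

Lemma parallelogram z w :
  `|w - z| ^+ 2 + `|w + z| ^+ 2 = 2 * (`|w| ^+ 2 + `|z| ^+ 2).
Proof. rewrite !normCK rmorphB rmorphD /=; ring. Qed.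

Lemma sqrt_near z (v : C) : exists2 w, w ^+ 2 = v & `|w - z| <= `|w + z|.
Proof.
have [le|lt] := real_leP (normr_real (sqrtC v - z)) (normr_real (sqrtC v + z)).
  by exists (sqrtC v); rewrite ?sqrtCK.
exists (- sqrtC v); first by rewrite sqrrN sqrtCK.
by rewrite -opprD normrN [- _ + _]addrC -opprB normrN ltW.
Qed.

(* The squared error halves at each step because, for [|w| = |z|], the nearer
   square root [w] of [v] satisfies [|w + z|^2 >= 2 |z|^2], by the parallelogram
   law, while [|w - z| |w + z| = |v - z^2|]. *)
Lemma root_approx k z : exists2 w, w ^+ (2 ^ k) = `|z| ^+ (2 ^ k) &
  `|w - z| ^+ 2 * 2 ^+ k <= 4 * `|z| ^+ 2.
Proof.
elim: k z => [|k IH] z.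
  exists `|z|; first by [].
  rewrite expr0 mulr1 -[4]/(2 ^ 2)%:R natrX -exprMn ler_sqr ?nnegrE ?mulr_ge0//.
  by rewrite (le_trans (ler_normB _ _))// normr_id -mulr2n mulr_natl.
have [->|z0] := eqVneq z 0.
  exists 0; first by rewrite normr0.
  by rewrite subr0 normr0 expr0n mul0r mulr0.
have [v vk vz] := IH (z ^+ 2); have [w wv le] := sqrt_near z v.
exists w; first by rewrite expnS exprM wv vk normrX -exprM.
have nv : `|v| = `|z| ^+ 2.
  apply/eqP; rewrite -(eqrXn2 (expn_gt0 2 k)) ?exprn_ge0//.
  by rewrite -normrX vk normrX normr_id normrX.
have nw : `|w| ^+ 2 = `|z| ^+ 2 by rewrite -normrX wv.
have zp : 0 < `|z| ^+ 2 by rewrite exprn_gt0// normr_gt0.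
have big : 2 * `|z| ^+ 2 <= `|w + z| ^+ 2.
  rewrite -(ler_pM2l (ltr0n _ 2)).
  rewrite (_ : 2 * (2 * _) = 2 * (`|w| ^+ 2 + `|z| ^+ 2)).
    by rewrite -parallelogram mulr_natl mulr2n lerD2r ler_sqr ?nnegrE.
  by rewrite nw; ring.
rewrite -(ler_pM2r zp) -mulrA.
have -> : 2 ^+ k.+1 * `|z| ^+ 2 = 2 * `|z| ^+ 2 * 2 ^+ k by rewrite exprS; ring.
have : `|w - z| ^+ 2 * `|w + z| ^+ 2 * 2 ^+ k <= 4 * `|z| ^+ 2 * `|z| ^+ 2.
  rewrite -exprMn -normrM -subr_sqr wv (le_trans vz)// normrX.
  by rewrite (_ : 4 * _ * _ = 4 * (`|z| ^+ 2) ^+ 2)//; ring.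
apply: le_trans; rewrite -(mulrA (`|w - z| ^+ 2)) ler_wpM2l ?exprn_ge0//.
by rewrite ler_wpM2r ?exprn_ge0.
Qed.

(** The radius lives in [C] itself, where [0 < e] forces [e] to be real. *)
Definition adherent (A : set C) : set C :=
  [set z | forall e : C, 0 < e -> exists2 s, A s & `|s - z| < e].

Lemma adherent_idem (A : set C) : adherent (adherent A) `<=` adherent A.
Proof.
move=> z Az e e0; have e2 : 0 < e / 2 by rewrite divr_gt0.
have [s As sz] := Az _ e2; have [t At ts] := As _ e2.
by exists t; rewrite // (le_lt_trans (ler_distD s _ _))// [e]splitr ltrD.
Qed.

(** The nearer square root w of s satisfies |w - z|^2 <= |w - z| |w + z| = |s - z^2|, so
    approximating z^2 within e^2 suffices. *)
Lemma adherent_sqrt (A : set C) z : (forall w, A (w ^+ 2) -> A w) ->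
  adherent A (z ^+ 2) -> adherent A z.
Proof.
move=> sqA Az e e0; have [s As sz] := Az _ (exprn_gt0 2 e0).
have [w ws le] := sqrt_near z s; exists w; first by apply: sqA; rewrite ws.
rewrite -ltr_sqr ?nnegrE ?(ltW e0)// (le_lt_trans _ sz)//.
by rewrite -ws subr_sqr normrM expr2 ler_wpM2l.
Qed.

Hypothesis archi : forall e : C, 0 < e -> exists k, 1 < e * 2 ^+ k.

Lemma root_approx_lt z (e : C) : 0 < e -> exists2 k, (2 < k)%N &
  exists2 w, w ^+ (2 ^ k) = `|z| ^+ (2 ^ k) & `|w - z| < e.
Proof.
move=> e0; have c0 : 0 < 4 * `|z| ^+ 2 + 1.
  by rewrite ltr_wpDl// mulr_ge0// exprn_ge0.
(* The [+ 1] keeps the divisor positive when z = 0. *)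
have [k] : exists k, 1 < e ^+ 2 / (4 * `|z| ^+ 2 + 1) * 2 ^+ k.
  by apply: archi; rewrite divr_gt0 ?exprn_gt0.
rewrite mulrAC ltr_pdivlMr// mul1r => lek.
exists k.+3 => //; have [w wk le] := root_approx k.+3 z; exists w => //.
rewrite -ltr_sqr ?nnegrE ?(ltW e0)// -(@ltr_pM2r _ (2 ^+ k.+3)) ?exprn_gt0//.
rewrite (le_lt_trans le)// (@lt_trans _ _ (4 * `|z| ^+ 2 + 1)) ?ltrDl//.
rewrite (lt_le_trans lek)// ler_pM2l ?exprn_gt0// ler_eXn2l ?ltr1n//; lia.
Qed.

(** Write t = u + u^* with |u| = 1. Since |u| = 1, [root_approx_lt] yields a root of unity w near u,
    and w + 1/w = w + w^* is within 2 |w - u| of t. *)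
Lemma unit_interval_adherent (t : C) : 0 <= t <= 1 -> adherent (signroots C) t.
Proof.
move=> /andP[t0 t1] e e0.
have [u u1 ut] : exists2 u : C, `|u| = 1 & u + u^* = t.
  pose y := sqrtC (1 - (t / 2) ^+ 2).
  have y0 : 0 <= 1 - (t / 2) ^+ 2.
    rewrite subr_ge0 expr_le1// ?divr_ge0// ler_pdivrMr// mul1r.
    by rewrite (le_trans t1)// ler1n.
  have tr : t / 2 \is Num.real by rewrite ger0_real// divr_ge0.
  have yr : y \is Num.real by rewrite ger0_real// sqrtC_ge0.
  exists (t / 2 + 'i * y).
    apply/eqP; rewrite -(@pexpr_eq1 _ _ 2)// normC2_rect// sqrtCK.
    by apply/eqP; ring.
  by rewrite conjC_rect//; field.
have e2 : 0 < 2 + e by rewrite addr_gt0.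
(* [e / (2 + e)] is below both [e / 2] and [1]. *)
have [k k2 [w wk wu]] := @root_approx_lt u (e / (2 + e)) (divr_gt0 e0 e2).
rewrite u1 expr1n in wk.
have w1 : `|w| = 1.
  apply/eqP; rewrite -(@pexpr_eq1 _ _ (2 ^ k)) ?expn_gt0//.
  by rewrite -normrX wk normr1.
have wV : w^-1 = w^* by rewrite invC_norm w1 expr1n invr1 mul1r.
exists (w + w^-1).
  apply: (@unity_root_signroots _ _ (2 ^ k.-1)).
  - by rewrite -[2%N]/(2 ^ 1)%N ltn_exp2l//; lia.
  - by rewrite -mul2n -expnS prednK//; lia.
  - apply: contraL (wu) => /eqP ww; rewrite -real_leNgt//; last first.
      by rewrite ger0_real// divr_ge0// ltW.
    (* [w = 1] or [w = -1] would give [|w - u|^2 = 2 - w t >= 1]. *)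
    have w0 : w != 0 by rewrite -normr_gt0 w1.
    have wc : w^* = w by apply: (mulfI w0); rewrite -wV mulfV// -expr2 ww.
    apply: (@le_trans _ _ 1); first by rewrite ler_pdivrMr// mul1r lerDr.
    rewrite -(@ler_sqr _ 1) ?nnegrE// expr1n normCK rmorphB /= wc.
    have -> : (w - u) * (w - u^*) = w ^+ 2 - w * (u + u^*) + u * u^* by ring.
    rewrite -normCK u1 expr1n ww ut addrAC lerBrDr.
    have wr : w \is Num.real by rewrite CrealE wc.
    have wtr : w * t \is Num.real by rewrite realM// ger0_real.
    rewrite lerD2l (le_trans (real_ler_norm wtr))//.
    by rewrite normrM w1 mul1r ger0_norm.
rewrite -ut wV opprD addrACA -rmorphB /= (le_lt_trans (ler_normD _ _))//.
rewrite norm_conjC -mulr2n -mulr_natl.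
apply: (@lt_le_trans _ _ (2 * (e / (2 + e)))); first by rewrite ltr_pM2l.
by rewrite mulrA ler_pdivrMr// mulrDr [e * 2]mulrC lerDl mulr_ge0 ?(ltW e0).
Qed.

Lemma closed_unit_disk_adherent :
  closed_unit_disk C `<=` adherent (signroots C).
Proof.
move=> z z1; apply: adherent_idem => e e0.
have [k _ [w wk wz]] := root_approx_lt z e0; exists w => //.
have : adherent (signroots C) (w ^+ (2 ^ k)).
  by rewrite wk; apply: unit_interval_adherent; rewrite exprn_ge0// exprn_ile1.
(* Adherence passes from w^(2^k) down to w, one square root at a time. *)
elim: k w {wk wz} => [|k IH] w; first by rewrite expr1.
rewrite expnS exprM => /IH; apply: adherent_sqrt => x; exact: signroots_sqrt.
Qed.

End ComplexApproximation.

Lemma complex_archi (R : realType) (e : R[i]) :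
  0 < e -> exists k, 1 < e * 2 ^+ k.
Proof.
move=> e0; have er : (complex.Re e)%:C%C = e by rewrite RRe_real// gtr0_real.
have r0 : 0 < complex.Re e by rewrite -ltcR er.
(* A positive [e] equals its real part, so the Archimedean bound of [R] applies: 1/e < 2^k for this
   k. *)
exists (Num.bound (complex.Re e)^-1).
rewrite -er -[2](rmorphMn (real_complex R) 2 1) -rmorphXn -rmorphM.
rewrite -(rmorph1 (real_complex R)) ltcR -ltr_pdivrMl// mulr1.
exact: upper_nthrootP.
Qed.

Theorem mainTheorem2 (R : realType) :
  closure (sigma_infty R[i] : set (R[i] : numFieldType))
    `&` closed_unit_disk R[i] = closed_unit_disk R[i].
Proof.
apply/setIidPr => z z1 B /nbhs_ballP[e /= e0 zB].
have [s ss sz] := closed_unit_disk_adherent (@complex_archi R) z1 e0.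
exists s; split; first exact: signroots_sub_sigma_infty.
by apply: zB; rewrite /ball /= distrC.
Qed.
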